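(* Let $k\geq 3$ be an integer. The following two statements are equivalent: (1) For all integers $n\geq m\geq 3$, $$R(\mathcal{P}^k_n,\mathcal{P}^k_m)=R(\mathcal{P}^k_n,\mathcal{C}^k_m)=R(\mathcal{C}^k_n,\mathcal{C}^k_m)+1=(k-1)n+\left\lfloor\frac{m+1}{2}\right\rfloor .$$ (2) For all integers $n\geq m\geq 3$, $$R(\mathcal{C}^k_n,\mathcal{C}^k_m)=(k-1)n+\left\lfloor\frac{m-1}{2}\right\rfloor .$$
   Context: For $k$-uniform hypergraphs $\mathcal{G},\mathcal{H}$, the Ramsey number $R(\mathcal{G},\mathcal{H})$ is the smallest integer $N$ such that every red-blue coloring of the edges of the complete $k$-uniform hypergraph $\mathcal{K}^k_N$ on $N$ vertices contains a red copy of $\mathcal{G}$ or a blue copy of $\mathcal{H}$ (copies are sub-hypergraphs, not necessarily induced). The $k$-uniform loose cycle $\mathcal{C}^k_n$ (cycle of length $n$) has vertex set $\{v_1,\ldots,v_{n(k-1)}\}$ and the $n$ edges $e_i=\{v_{(i-1)(k-1)+1},v_{(i-1)(k-1)+2},\ldots,v_{i(k-1)+1}\}$, $i=1,\ldots,n$, with subscripts taken mod $n(k-1)$. The $k$-uniform loose path $\mathcal{P}^k_n$ (path of length $n$) has vertex set $\{v_1,\ldots,v_{n(k-1)+1}\}$ and the $n$ edges $e_i=\{v_{(i-1)(k-1)+1},\ldots,v_{i(k-1)+1}\}$, $i=1,\ldots,n$ (no reduction of subscripts). *)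

(* Defs.v *)
From mathcomp Require Import all_boot.

Set Implicit Arguments.
Unset Strict Implicit.
Unset Printing Implicit Defensive.

Record hypergraph := Hypergraph {
  vertex : finType;
  edges : {set {set vertex}}
}.

Definition uniform (k : nat) (G : hypergraph) : Prop :=
  forall e : {set vertex G}, e \in edges G -> #|e| = k.

Definition complete (k N : nat) : hypergraph :=
  @Hypergraph 'I_N [set e : {set 'I_N} | #|e| == k].

(* A copy need not be induced and need not span. *)
Definition contains_copy (F G : hypergraph) : Prop :=
  exists f : vertex G -> vertex F,
    injective f /\ forall e, e \in edges G -> f @: e \in edges F.

Definition colour_class (F : hypergraph) (c : {set vertex F} -> bool)
    (b : bool) : hypergraph :=
  @Hypergraph (vertex F) [set e in edges F | c e == b].

(* The colour [true] is red and [false] is blue; the values of a colouring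
   outside the edges of the complete hypergraph are irrelevant. *)
Definition ramsey_arrows (k N : nat) (G H : hypergraph) : Prop :=
  forall c : {set vertex (complete k N)} -> bool,
    contains_copy (colour_class c true) G \/
    contains_copy (colour_class c false) H.

(* [is_ramsey k G H N] is the assertion R(G, H) = N for [k]-uniform [G], [H].
   It is a relation, so that it includes the existence of the Ramsey number. *)
Definition is_ramsey (k : nat) (G H : hypergraph) (N : nat) : Prop :=
  ramsey_arrows k N G H /\ forall M, ramsey_arrows k M G H -> N <= M.

(* Vertices and edges are numbered from 0: the vertex v_(t+1) is [t] and the
   edge e_(i+1) is [loose_path_edge k i] (resp. [loose_cycle_edge k i]). *)
Definition loose_path_edge (k n : nat) (i : 'I_n) : {set 'I_(n * (k - 1) + 1)} :=
  [set v | [exists j : 'I_k, val v == i * (k - 1) + j]].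

Definition loose_path (k n : nat) : hypergraph :=
  @Hypergraph 'I_(n * (k - 1) + 1) [set loose_path_edge k i | i : 'I_n].

Definition loose_cycle_edge (k n : nat) (i : 'I_n) : {set 'I_(n * (k - 1))} :=
  [set v | [exists j : 'I_k, val v == (i * (k - 1) + j) %% (n * (k - 1))]].

Definition loose_cycle (k n : nat) : hypergraph :=
  @Hypergraph 'I_(n * (k - 1)) [set loose_cycle_edge k i | i : 'I_n].

Lemma loose_path_uniform (k n : nat) : 0 < k -> uniform k (loose_path k n).
Proof.
move=> k0 e /imsetP[i _ ->] {e}.
have hlt (j : 'I_k) : i * (k - 1) + j < n * (k - 1) + 1.
  rewrite addn1 ltnS (@leq_trans (i.+1 * (k - 1))) ?leq_mul2r ?ltn_ord ?orbT //.
  by rewrite mulSn addnC leq_add2r subn1 -ltnS prednK.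
have -> : loose_path_edge k i = [set Ordinal (hlt j) | j : 'I_k].
  apply/setP=> v; rewrite inE; apply/existsP/imsetP => [[j /eqP hj]|[j _ ->]].
    by exists j => //; apply: val_inj.
  by exists j.
by rewrite card_imset ?card_ord // => a b [] /addnI/val_inj.
Qed.

Lemma loose_cycle_uniform (k n : nat) :
  1 < k -> 1 < n -> uniform k (loose_cycle k n).
Proof.
move=> k1 n1 e /imsetP[i _ ->] {e}.
have hk : k <= n * (k - 1).
  rewrite (@leq_trans (2 * (k - 1))) ?leq_mul2r ?n1 ?orbT //.
  by case: k k1 => [|[|k]] // _; rewrite subn1 mul2n -addnn addSnnS leq_addl.
have h0 : 0 < n * (k - 1) by apply: leq_trans hk; apply: ltnW.
have -> : loose_cycle_edge k i =
    [set Ordinal (ltn_pmod (i * (k - 1) + j) h0) | j : 'I_k].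
  apply/setP=> v; rewrite inE; apply/existsP/imsetP => [[j /eqP hj]|[j _ ->]].
    by exists j => //; apply: val_inj.
  by exists j.
rewrite card_imset ?card_ord // => a b [] /eqP.
rewrite eqn_modDl !modn_small ?(leq_trans (ltn_ord _) hk) // => /eqP.
exact: val_inj.
Qed.

(* Main.v *)
Require Import Defs.
From mathcomp Require Import all_boot zify.

Set Implicit Arguments.
Unset Strict Implicit.
Unset Printing Implicit Defensive.

(** The first statement contains the second up to arithmetic. For the converse
    put N = (k-1)n + ceil(m/2); both path formulas have to be derived from the
    cycle formula, whose value is N - 1.

    Lower bounds: split N - 1 vertices into a part A of size (k-1)n and a rest
    of size ceil(m/2) - 1, and colour red the edges inside A. A red path of
    length n does not fit into A, and a blue path or cycle of length m would be
    covered by the rest, although each vertex lies in at most two of its m edges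
    ([path_lower_bound]).

    Upper bounds: suppose that one colour has a loose cycle of length p but no
    loose path of length p. Deleting an edge of the cycle leaves a path of length
    p - 1 ending at the two joints of the deleted edge, so an edge made of one of
    these joints, vertices of the interior of the deleted edge and vertices
    outside the cycle would prolong it; it must have the other colour
    ([cycle_frame]). In particular an edge of the cycle takes the other colour
    when one of its joints is exchanged for an outside vertex. Such edges are
    chained alternately at every second joint of the cycle and at outside
    vertices, so that one outside vertex serves two edges ([zigzag]).

    For P_n against C_m, the cycle formula gives a blue C_m or a red C_n. In the
    second case N leaves ceil(m/2) vertices outside the red cycle, which is
    what the chain needs to close up to a blue C_m ([frame_cycle]).

    For P_n against P_m, the previous result allows to start from a blue C_m. If
    there is no blue P_m, the chain runs through all m edges of this cycle and
    d = n - m red edges remain to be added. If 0 < d < m, they are formed by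
    outside vertices, paired at the joints that the chain has left free
    ([frame_long_path]). If m <= d, there are enough outside vertices to find a
    red P_d among them by induction on n, and the chain is attached to it; if
    d = 0, a single outside vertex takes the place of that path
    ([frame_attach]). *)

(** * Loose paths as inductively grown sets *)

Section LoosePaths.

Variables (T : finType) (k : nat) (Q : {set T} -> bool).
Implicit Types (U S D : {set T}) (u v w x y : T).

(** [lpath U n u v]: a loose path of length [n] from [u] to [v] with vertex set
    [U] and edges in [Q]. A path grows by one edge when [k - 1] fresh vertices
    are joined to its end, and any of them may become the new end. Recording
    only the vertex set and the two ends makes gluing and rerouting a matter of
    disjointness of sets. *)
Inductive lpath : {set T} -> nat -> T -> T -> Prop :=
| lpath_point u : lpath [set u] 0 u u
| lpath_step U n u v S w :
    lpath U n u v -> (forall z, z \in S -> z \notin U) -> #|S| = k - 1 ->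
    w \in S -> Q (v |: S) -> lpath (S :|: U) n.+1 u w.

(** For a colour class [Q] this is containment of a copy of [G], relative to a
    part [W] of the vertex set, on an arbitrary finite type. *)
Definition copy_in (W : {set T}) (G : hypergraph) : Prop :=
  exists f : vertex G -> T, [/\ injective f, forall t, f t \in W
    & forall e, e \in edges G -> Q (f @: e)].

Lemma lpath_ends U n u v : lpath U n u v -> u \in U /\ v \in U.
Proof.
elim=> [{}u|{}U {}n {}u {}v S w _ [uU vU] dis _ wS _]; first by rewrite !inE.
by rewrite !inE uU wS orbT.
Qed.

Lemma lpath_neq U n u v : 0 < n -> lpath U n u v -> u != v.
Proof.
move=> n0 P; case: P n0 => // {}U {}n {}u {}v S w P dis _ wS _ _.
by apply: contraTneq (lpath_ends P).1 => ->; apply: dis.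
Qed.

Lemma card_lpath U n u v : lpath U n u v -> #|U| = n * (k - 1) + 1.
Proof.
elim=> [{}u|{}U {}n {}u {}v S w _ IH dis cS _ _]; first by rewrite cards1.
rewrite cardsU IH cS (_ : S :&: U = set0) ?cards0; first by rewrite mulSn; lia.
by apply/setP=> z; rewrite !inE; apply/negP=> /andP[/dis/negP].
Qed.

(** A path can grow at its start as well. Inductively the new edge is pushed
    below all the others; in the base case the one edge is read backwards. *)
Lemma lpath_prepend U n u v S s :
  lpath U n u v -> (forall z, z \in S -> z \notin U) -> #|S| = k - 1 ->
  s \in S -> Q (u |: S) -> lpath (S :|: U) n.+1 s v.
Proof.
elim=> {U n u v} [u|U n u v S' w _ IH dis' cS' wS' QS'] dis cS sS QS.
  have us : u \notin S by apply/negP=> /dis; rewrite inE eqxx.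
  have -> : S :|: [set u] = (u |: S :\ s) :|: [set s].
    apply/setP=> z; rewrite !inE; case: (eqVneq z s) => [->|_] //=.
      by rewrite sS orbT.
    by rewrite orbF orbC.
  apply: (lpath_step (lpath_point s)).
  - move=> z; rewrite !inE => /orP[/eqP->|/andP[]//].
    by apply: contraNneq us => ->.
  - have := cardsD1 s S; rewrite cardsU1 sS !inE (negPf us) andbF /=; lia.
  - by rewrite !inE eqxx.
  - suff -> : s |: (u |: S :\ s) = u |: S by [].
    by rewrite setUCA setD1K.
rewrite setUCA; apply: (lpath_step (IH _ _ _ _)) => //.
- by move=> z /dis; rewrite inE negb_or => /andP[].
- move=> z zS'; rewrite inE negb_or dis' // andbT.
  by apply/negP=> /dis; rewrite inE zS'.
Qed.

(** The unit from which all long paths below are assembled: two edges with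
    interiors [D1] and [D2] that share the fresh vertex [x]. *)
Lemma lpath_step2 U n u w x D1 D2 w' :
  lpath U n u w ->
  [/\ forall z, z \in D1 -> z \notin U, forall z, z \in D2 -> z \notin U,
      forall z, z \in D1 -> z \notin D2, x \notin U :|: D1 :|: D2
    & w' \notin x |: (U :|: D1 :|: D2)] ->
  #|D1| = k - 2 -> #|D2| = k - 2 -> 2 < k ->
  Q (x |: (w |: D1)) -> Q (x |: (w' |: D2)) ->
  lpath (w' |: (x |: (D1 :|: D2 :|: U))) n.+2 u w'.
Proof.
move=> P [D1U D2U D12 xN wN] c1 c2 k2 Q1 Q2.
move: xN wN; rewrite !inE !negb_or => /andP[/andP[xU x1] x2].
move=> /andP[wx /andP[/andP[wU w1] w2]].
have -> : w' |: (x |: (D1 :|: D2 :|: U)) = (w' |: D2) :|: ((x |: D1) :|: U).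
  by apply/setP=> z; rewrite !inE; do !case: (_ \in _); rewrite /= ?orbT ?orbF.
apply: (@lpath_step _ _ _ x).
- apply: lpath_step P _ _ _ _; rewrite ?setU11 //.
  + by move=> z /setU1P[->//|/D1U].
  + by rewrite cardsU1 x1 c1; lia.
  + by rewrite setUCA.
- move=> z /setU1P[->|z2]; rewrite !inE !negb_or ?wx ?wU ?w1 //.
  rewrite D2U // andbT (contraTneq _ z2); last by move=> ->.
  by apply: contraTN z2 => /D12.
- by rewrite cardsU1 w2 c2; lia.
- exact: setU11.
- by [].
Qed.

Lemma set_nth_take_drop (s : seq T) x0 a b :
  a + b <= size s ->
  [set z in take b (drop a s)] = [set nth x0 s (a + j) | j : 'I_b].
Proof.
move=> ab; have sz : size (take b (drop a s)) = b.
  by rewrite size_takel // size_drop; lia.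
apply/setP=> z; rewrite inE; apply/(nthP x0)/imsetP => [[j]|[j _ ->]].
  rewrite sz => jb <-; exists (Ordinal jb) => //=.
  by rewrite nth_take // nth_drop.
by exists j; rewrite ?sz ?ltn_ord // nth_take ?ltn_ord // nth_drop.
Qed.

(** Listing the vertices along the path, each edge is a window of length [k],
    and consecutive windows overlap in one entry. *)
Lemma lpath_seq U n u v : 0 < k -> lpath U n u v ->
  exists s : seq T, [/\ uniq s, s =i U, size s = n * (k - 1) + 1,
    drop (n * (k - 1)) s = [:: v] /\ nth u s 0 = u &
    forall i, i < n -> Q [set z in take k (drop (i * (k - 1)) s)]].
Proof.
move=> k0.
elim=> {U n u v} [u|U n u v S w P [s [us sU ss [sd s0] sQ]] dis cS wS QS].
  by exists [:: u]; split=> // z; rewrite !inE.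
have cw : size (enum (S :\ w)) = k - 2.
  by rewrite -cardE; have := cardsD1 w S; rewrite wS; lia.
have k1 : 1 < k by have := cardsD1 w S; rewrite wS; lia.
(* The end of the new edge has to come last in the list. *)
pose t := rcons (enum (S :\ w)) w.
have tS : t =i S.
  move=> z; rewrite mem_rcons inE mem_enum !inE.
  by case: (eqVneq z w) => [->|].
exists (s ++ t); split.
- have ut : uniq t by rewrite rcons_uniq enum_uniq mem_enum !inE eqxx.
  rewrite cat_uniq us ut andbT.
  by apply/hasPn=> z; rewrite tS => /dis; rewrite sU.
- by move=> z; rewrite mem_cat tS sU !inE orbC.
- by rewrite size_cat ss size_rcons cw mulSn; lia.
- split; last by rewrite nth_cat ss addn1 s0.
  rewrite drop_cat ss ifF; last by rewrite mulSn; lia.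
  rewrite (_ : _ - _ = size (enum (S :\ w))); last by rewrite cw mulSn; lia.
  by rewrite /t -cats1 drop_size_cat.
- move=> i; rewrite ltnS leq_eqVlt => /orP[/eqP->|lin].
    rewrite drop_cat ss ifT; last by lia.
    rewrite sd (_ : [set z in _] = v |: S) //.
    apply/setP=> z; rewrite !inE -tS.
    by rewrite take_oversize ?inE //= size_rcons cw; lia.
  have le : i * (k - 1) + k <= size s by rewrite ss; nia.
  rewrite drop_cat ifT; last by lia.
  by rewrite takel_cat ?sQ // size_drop; lia.
Qed.

Lemma lpath_copy U n u v : 0 < k -> lpath U n u v -> copy_in U (loose_path k n).
Proof.
move=> k0 P; have [s [us sU ss [sd s0] sQ]] := lpath_seq k0 P.
exists (fun t : 'I_(n * (k - 1) + 1) => nth u s t); split.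
- move=> a b /eqP; rewrite nth_uniq ?ss ?ltn_ord // => /eqP; exact: val_inj.
- by move=> t; rewrite -sU mem_nth // ss.
- move=> e /imsetP[i _ ->]; have := sQ i (ltn_ord i).
  have le : i * (k - 1) + k <= n * (k - 1) + 1 by have := ltn_ord i; nia.
  rewrite (set_nth_take_drop u) ?ss //; congr Q.
  apply/setP=> z; apply/imsetP/imsetP=> [[j _ ->]|[t + ->]].
    have lt : i * (k - 1) + j < n * (k - 1) + 1 by have := ltn_ord j; lia.
    by exists (Ordinal lt) => //; rewrite inE; apply/existsP; exists j.
  by rewrite inE => /existsP[j /eqP tj]; exists j; rewrite -?tj.
Qed.

(** A loose cycle is a loose path whose two ends are joined by one more edge
    with interior [D]. *)
Lemma lpath_close_copy U n u v D :
  1 < k -> 0 < n -> lpath U n u v -> (forall z, z \in D -> z \notin U) ->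
  #|D| = k - 2 -> Q (u |: (v |: D)) -> copy_in (D :|: U) (loose_cycle k n.+1).
Proof.
move=> k1 n0 P dis cD QD; have [s [us sU ss [sd s0] sQ]] := lpath_seq (ltnW k1) P.
pose s' := s ++ enum D.
have ss' : size s' = n.+1 * (k - 1).
  by rewrite size_cat ss -cardE cD mulSn; lia.
have us' : uniq s'.
  rewrite cat_uniq us enum_uniq andbT.
  by apply/hasPn=> z; rewrite mem_enum => /dis; rewrite sU.
have sU' z : (z \in s') = (z \in D :|: U) by rewrite mem_cat mem_enum sU inE orbC.
exists (fun t : 'I_(n.+1 * (k - 1)) => nth u s' t); split.
- move=> a b /eqP; rewrite nth_uniq ?ss' ?ltn_ord // => /eqP; exact: val_inj.
- by move=> t; rewrite -sU' mem_nth // ss'.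
- move=> e /imsetP[i _ ->]; have := ltn_ord i; rewrite ltnS leq_eqVlt.
  case/orP=> [/eqP lin|lin].
    (* The last edge wraps around to the first vertex [u]. *)
    suff -> : [set nth u s' t | t : 'I__ in loose_cycle_edge k i]
        = u |: (v |: D) by [].
    have dv : drop (n * (k - 1)) s' = v :: enum D.
      by rewrite drop_cat ss ifT ?sd //; lia.
    have nthv j : nth u s' (n * (k - 1) + j) = nth u (v :: enum D) j.
      by rewrite -nth_drop dv.
    have s0' : nth u s' 0 = u by rewrite nth_cat ss addn1 s0.
    apply/setP=> z; apply/imsetP/idP=> [[t + ->]|].
      rewrite inE => /existsP[j /eqP ->]; rewrite lin.
      have [jk|jk] := ltnP j (k - 1); last first.
        rewrite (_ : _ + j = n.+1 * (k - 1)); last first.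
          by rewrite mulSn; have := ltn_ord j; lia.
        by rewrite modnn s0' !inE eqxx.
      rewrite modn_small; last by rewrite mulSn; lia.
      rewrite nthv inE; apply/orP; right.
      have : nth u (v :: enum D) j \in v :: enum D.
        by rewrite mem_nth //= -cardE cD; lia.
      by rewrite !inE mem_enum.
    case/setU1P=> [->|zv].
      have lt : 0 < n.+1 * (k - 1) by rewrite muln_gt0 subn_gt0.
      exists (Ordinal lt) => //=; rewrite inE; apply/existsP.
      have lt2 : k - 1 < k by lia.
      by exists (Ordinal lt2) => /=; rewrite lin addnC -mulSn modnn.
    have zs : z \in v :: enum D by move: zv; rewrite !inE mem_enum.
    have ji : index z (v :: enum D) < (k - 1).
      by move: zs; rewrite -index_mem /= -cardE cD; lia.
    have lt : n * (k - 1) + index z (v :: enum D) < n.+1 * (k - 1).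
      by rewrite mulSn; lia.
    exists (Ordinal lt); last by rewrite nthv nth_index.
    rewrite inE; apply/existsP.
    have lt2 : index z (v :: enum D) < k by lia.
    by exists (Ordinal lt2) => /=; rewrite lin modn_small.
  have le : i * (k - 1) + k <= n * (k - 1) + 1 by nia.
  have := sQ i lin; rewrite (set_nth_take_drop u) ?ss //; congr Q.
  have sm (j : 'I_k) : i * (k - 1) + j < n.+1 * (k - 1).
    by have := ltn_ord j; rewrite mulSn; nia.
  have nths (j : 'I_k) : nth u s' (i * (k - 1) + j) = nth u s (i * (k - 1) + j).
    by rewrite nth_cat ss ifT //; have := ltn_ord j; lia.
  apply/setP=> z; apply/imsetP/imsetP=> [[j _ ->]|[t + ->]].
    exists (Ordinal (sm j)); last by rewrite /= nths.
    by rewrite inE; apply/existsP; exists j; rewrite modn_small.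
  rewrite inE => /existsP[j /eqP tj]; exists j => //.
  by rewrite tj modn_small ?nths.
Qed.

(** The offset [a] serves to start reading a cyclic numbering at any place. *)
Lemma lpath_of_fun (g : nat -> T) a n :
  1 < k ->
  (forall s t, a <= s < t -> t <= a + n * (k - 1) -> g s <> g t) ->
  (forall i, i < n -> Q [set g (a + i * (k - 1) + j) | j : 'I_k]) ->
  lpath [set g (a + j) | j : 'I_(n * (k - 1) + 1)] n (g a) (g (a + n * (k - 1))).
Proof.
move=> k1; elim: n => [|n IH] gi gQ; last have E := mulSn n (k - 1).
  rewrite mul0n addn0.
  suff -> : [set g (a + j) | j : 'I_(0 + 1)] = [set g a] by exact: lpath_point.
  apply/setP=> z; rewrite inE; apply/imsetP/eqP=> [[j _ ->]|->].
    by rewrite (ord1 j) addn0.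
  by exists ord0 => //; rewrite addn0.
pose S := [set g (a + n * (k - 1) + 1 + j) | j : 'I_(k - 1)].
have -> : [set g (a + j) | j : 'I_(n.+1 * (k - 1) + 1)]
   = S :|: [set g (a + j) | j : 'I_(n * (k - 1) + 1)].
  apply/setP=> z; rewrite inE; apply/imsetP/orP.
    case=> j _ ->; have [jn|jn] := ltnP j (n * (k - 1) + 1).
      by right; apply/imsetP; exists (Ordinal jn).
    left; have lt : j - (n * (k - 1) + 1) < k - 1.
      by have := ltn_ord j; lia.
    by apply/imsetP; exists (Ordinal lt) => //=; congr g; lia.
  case=> /imsetP[j _ ->].
    have lt : n * (k - 1) + 1 + j < n.+1 * (k - 1) + 1.
      by have := ltn_ord j; lia.
    by exists (Ordinal lt) => //=; congr g; lia.
  have lt : j < n.+1 * (k - 1) + 1 by have := ltn_ord j; lia.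
  by exists (Ordinal lt).
apply: lpath_step.
- apply: IH => [s t st tn|i lin]; last by apply: gQ; lia.
  by apply: gi => //; lia.
- move=> z /imsetP[j _ ->]; apply/imsetP=> -[i _] /esym.
  by apply: gi; have := ltn_ord i; have := ltn_ord j; lia.
- rewrite card_imset ?card_ord // => i j gij; apply/val_inj => /=.
  move: gij (ltn_ord i) (ltn_ord j).
  move: (nat_of_ord i) (nat_of_ord j) => s t gst ls lt.
  have le : a + n * (k - 1) + 1 + maxn s t <= a + n.+1 * (k - 1) by lia.
  case: (ltngtP s t) => // st; [case: (gi _ _ _ _ gst) |
    case: (gi _ _ _ _ (esym gst))]; nia.
- have lt : k - 2 < k - 1 by lia.
  by apply/imsetP; exists (Ordinal lt) => //=; congr g; lia.
- have := gQ n (ltnSn n); congr Q; apply/setP=> z; rewrite !inE.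
  apply/imsetP/orP=> [[j _ ->]|[/eqP->|/imsetP[j _ ->]]].
  + have [j0|j0] := posnP j; first by left; rewrite j0 addn0.
    right; have lt : j.-1 < k - 1 by have := ltn_ord j; lia.
    by apply/imsetP; exists (Ordinal lt) => //=; congr g; lia.
  + by exists (Ordinal (ltnW k1)); rewrite ?addn0.
  + have lt : j.+1 < k by have := ltn_ord j; lia.
    by exists (Ordinal lt) => //=; congr g; lia.
Qed.

Lemma copy_lpath W n : 1 < k -> copy_in W (loose_path k n) ->
  exists U u v, lpath U n u v /\ U \subset W.
Proof.
move=> k1 [f [fi fW fQ]].
have lt0 : 0 < n * (k - 1) + 1 by rewrite addn1.
pose g t := f (insubd (Ordinal lt0) t).
have gE t (lt : t < n * (k - 1) + 1) : g t = f (Ordinal lt).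
  by congr f; apply: val_inj; rewrite val_insubd lt.
exists [set g (0 + j) | j : 'I_(n * (k - 1) + 1)], (g 0), (g (0 + n * (k - 1))).
split; last by apply/subsetP=> z /imsetP[j _ ->]; apply: fW.
apply: lpath_of_fun => // [s t st tn|i lin].
  have lt : t < n * (k - 1) + 1 by lia.
  have ls : s < n * (k - 1) + 1 by lia.
  by rewrite (gE _ lt) (gE _ ls) => /fi[]; lia.
have /fQ : loose_path_edge k (Ordinal lin) \in edges (loose_path k n).
  by apply/imsetP; exists (Ordinal lin).
have lt (j : 'I_k) : 0 + i * (k - 1) + j < n * (k - 1) + 1.
  by have := ltn_ord j; nia.
congr Q; apply/setP=> z; apply/imsetP/imsetP=> [[t + ->]|[j _ ->]].
  rewrite inE => /existsP[j /eqP tj]; exists j => //.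
  by rewrite (gE _ (lt j)); congr f; apply: val_inj.
rewrite (gE _ (lt j)); exists (Ordinal (lt j)) => //.
by rewrite inE; apply/existsP; exists j.
Qed.


(** * The colour opposite to a loose cycle *)

(** What a loose cycle with vertex set [V], joints [x i] and edge interiors
    [B i] (the edge [i] being [x i], [B i], [x i.+1]) says about the edges [Q]
    of the other colour, when no loose path of the same length [p] has the
    colour of the cycle. Only [frame_Q] speaks about colours: a joint of the
    edge [i] together with vertices that lie outside the cycle or in the
    interior of that edge is in [Q]. *)
Record frame (p : nat) (V : {set T}) (x : nat -> T) (B : nat -> {set T}) : Prop :=
  Frame {
    frame_x : forall i, x i \in V;
    frame_B : forall i z, i < p -> z \in B i -> z \in V;
    frame_inj : forall i j, i < p -> j < p -> x i = x j -> i = j;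
    frame_close : x p = x 0;
    frame_xB : forall i j, i < p -> j < p -> x i \notin B j;
    frame_BB : forall i j z, i < p -> j < p -> z \in B i -> z \in B j -> i = j;
    frame_card : forall i, i < p -> #|B i| = k - 2;
    frame_Q : forall i S, i < p -> #|S| = k - 1 ->
      (forall z, z \in S -> z \notin V \/ z \in B i) ->
      Q (x i |: S) /\ Q (x i.+1 |: S) }.

End LoosePaths.

Lemma copy_in_sub (T : finType) (Q : {set T} -> bool) (W W' : {set T}) G :
  W \subset W' -> copy_in Q W G -> copy_in Q W' G.
Proof.
move=> /subsetP sW [f [fi fW fQ]].
by exists f; split=> // t; apply/sW/fW.
Qed.

(** Without its edge [i] the cycle is a loose path of length [p - 1] whose ends
    are the two joints of that edge. An edge [x i |: S] or [x i.+1 |: S] with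
    [S] as in [frame_Q] would extend it to a loose path of length [p], so it
    does not have the colour of the cycle. *)
Lemma cycle_frame (T : finType) k (P Q : {set T} -> bool) p :
  2 < k -> 1 < p -> (forall e, ~~ P e -> Q e) ->
  copy_in P setT (loose_cycle k p) -> ~ copy_in P setT (loose_path k p) ->
  exists V x B, frame k Q p V x B /\ #|V| = p * (k - 1).
Proof.
move=> k2 p1 PQ [f [fi _ fP]] noP.
(* [g] unrolls the cycle: its numbering is read modulo the number of vertices. *)
pose L := p * (k - 1).
have L0 : 0 < L by rewrite muln_gt0 subn_gt0; lia.
pose g t := f (Ordinal (ltn_pmod t L0)).
have gE s t : (g s = g t) <-> s = t %[mod L].
  by split=> [/fi[]|e] //; congr f; apply: val_inj.
have gn s t : s < t < s + L -> g s <> g t.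
  move=> st /gE/eqP; rewrite eq_sym eqn_mod_dvd; last by lia.
  by move=> /dvdn_leq; lia.
have gs s t : s < L -> t < L -> g s = g t -> s = t.
  by move=> sL tL /gE; rewrite !modn_small.
have edge i : P [set g (i * (k - 1) + j) | j : 'I_k].
  have ip : i %% p < p by rewrite ltn_mod; lia.
  have /fP : loose_cycle_edge k (Ordinal ip) \in edges (loose_cycle k p).
    by apply/imsetP; exists (Ordinal ip).
  have E j : (i * (k - 1) + j) %% L = ((i %% p) * (k - 1) + j) %% L.
    by rewrite -modnDml -[in RHS]modnDml /L muln_modl modn_mod.
  congr P; apply/setP=> z; apply/imsetP/imsetP=> [[t + ->]|[j _ ->]].
    rewrite inE => /existsP[j /eqP tj]; exists j => //.
    by congr f; apply: val_inj; rewrite /= tj -E.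
  exists (Ordinal (ltn_pmod (i * (k - 1) + j) L0)) => //.
  by rewrite inE; apply/existsP; exists j => /=; rewrite E.
pose V := [set g t | t : 'I_L].
pose x i := g (i * (k - 1)).
pose B i := [set g (i * (k - 1) + 1 + j) | j : 'I_(k - 2)].
have gV t : g t \in V.
  apply/imsetP; exists (Ordinal (ltn_pmod t L0)) => //=.
  by apply/gE; rewrite modn_mod.
have sL i j : i < p -> j < k - 1 -> i * (k - 1) + j < L by rewrite /L; nia.
have jo := @ltn_ord (k - 2).
(* The cycle without the interior of its edge [i], from [x i.+1] round to [x i]. *)
pose U i := [set g (i.+1 * (k - 1) + j) | j : 'I_((p - 1) * (k - 1) + 1)].
have LE : L = k - 1 + (p - 1) * (k - 1) by rewrite /L -mulSn; congr muln; lia.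
have path i : lpath k P (U i) (p - 1) (x i.+1) (x i).
  have -> : x i = g (i.+1 * (k - 1) + (p - 1) * (k - 1)).
    by apply/gE; rewrite mulSn [X in X + _]addnC -addnA -LE modnDr.
  apply: lpath_of_fun => [|s t st tL|j jp]; [lia| apply: gn; lia|].
  by have := edge (i.+1 + j); rewrite mulnDl.
have UB i z : z \in U i -> z \notin B i.
  case/imsetP=> t _ ->; apply/imsetP=> -[j _] /esym; apply: gn.
  by rewrite mulSn; have := jo j; have := ltn_ord t; lia.
have new i (S : {set T}) z : (forall z, z \in S -> z \notin V \/ z \in B i) ->
    z \in S -> z \notin U i.
  move=> SV /SV[zV|zB]; last by apply: contraTN zB => /UB.
  by apply: contraNN zV => /imsetP[t _ ->].
exists V, x, B; split; last first.
  by rewrite card_imset ?card_ord // => s t /gs e; apply: val_inj; apply: e.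
split=> //.
- by move=> i; apply: gV.
- by move=> i z _ /imsetP[j _ ->].
- move=> i j ip jp /gs; rewrite -[i * _]addn0 -[j * _]addn0.
  move=> /(_ (sL _ _ ip _) (sL _ _ jp _)) => e.
  have {}e : i * (k - 1) = j * (k - 1).
    by rewrite -[LHS]addn0 -[RHS]addn0 e ?subn_gt0; lia.
  by apply/eqP; rewrite -(@eqn_pmul2r (k - 1)) ?e ?subn_gt0 //; lia.
- by apply/gE; rewrite mul0n mod0n modnn.
- move=> i j ip jp; apply/imsetP=> -[l _] /gs.
  have := sL _ 0 ip; have := sL _ l.+1 jp; have := jo l.
  rewrite addn0 addnAC -addnA addn1 => ll h1 h2 /(_ (h2 _) (h1 _)).
  move=> e; have {}e : i * (k - 1) = j * (k - 1) + l.+1 by apply: e; lia.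
  by have := congr1 (modn^~ (k - 1)) e; rewrite modnMl modnMDl modn_small; lia.
- move=> i j z ip jp /imsetP[l _ ->] /imsetP[l' _] /gs.
  have := sL _ l.+1 ip; have := sL _ l'.+1 jp; have := jo l; have := jo l'.
  rewrite -!addnA !add1n => ll ll' h1 h2 /(_ (h2 _) (h1 _)).
  move=> e; have {}e : i * (k - 1) + l.+1 = j * (k - 1) + l'.+1 by apply: e; lia.
  have := congr1 (divn^~ (k - 1)) e; rewrite !divnMDl ?subn_gt0; try lia.
  by rewrite !divn_small; lia.
- move=> i ip; rewrite card_imset ?card_ord // => s t /gs e; apply: val_inj.
  have := sL _ s.+1 ip; have := sL _ t.+1 ip; have := jo s; have := jo t.
  by move=> h1 h2 h3 h4; apply: (@addnI (i * (k - 1) + 1)); apply: e; lia.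
- move=> i S ip cS SV; have [s sS] : exists s, s \in S.
    by apply/set0Pn; rewrite -card_gt0 cS subn_gt0; lia.
  have p_1 : (p - 1).+1 = p by lia.
  have P' : 0 < k by lia.
  split; apply: PQ; apply/negP=> PS; apply: noP.
    have := lpath_step (path i) (fun z => new i S z SV) cS sS PS.
    by rewrite p_1 => /(lpath_copy P'); apply/copy_in_sub/subsetT.
  have := lpath_prepend (path i) (fun z => new i S z SV) cS sS PS.
  by rewrite p_1 => /(lpath_copy P'); apply/copy_in_sub/subsetT.
Qed.

Lemma exists_subset (T : finType) (A : {set T}) c :
  c <= #|A| -> exists2 D : {set T}, {subset D <= A} & #|D| = c.
Proof.
move=> cA; exists [set z in take c (enum A)].
  by move=> z; rewrite inE => /mem_take; rewrite mem_enum.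
rewrite cardsE (card_uniqP _) ?take_uniq ?enum_uniq //.
by rewrite size_takel // -cardE.
Qed.

(** * Long paths and cycles in the opposite colour *)

Section Frame.

Variables (T : finType) (k : nat) (Q : {set T} -> bool) (p : nat).
Variables (V : {set T}) (x : nat -> T) (B : nat -> {set T}).
Hypotheses (k2 : 2 < k) (F : frame k Q p V x B).
Implicit Types (U S D A : {set T}) (u v w : T).

Let k1 : 1 < k := ltnW k2.

Lemma frame_Qout i S : i < p -> #|S| = k - 1 ->
  (forall z, z \in S -> z \notin V) -> Q (x i |: S).
Proof. by move=> ip cS SV; apply: (frame_Q F ip cS _).1 => z /SV; left. Qed.

(** An edge of the cycle changes colour when one of its joints is exchanged
    for a vertex [w] outside. *)
Lemma frame_Qblock i w : i < p -> w \notin V ->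
  Q (x i |: (w |: B i)) /\ Q (x i.+1 |: (w |: B i)).
Proof.
move=> ip wV; apply: (frame_Q F ip).
  rewrite cardsU1 (frame_card F ip) (contraNN _ wV); first lia.
  exact: (frame_B F).
by move=> z /setU1P[->|]; [left|right].
Qed.

(** The part of the cycle used up by [zigzag]: the interiors of the edges
    [0], ..., [2j - 1] and the joints in the middle of the pairs
    ([2i], [2i + 1]). The joints with even index stay free. *)
Fixpoint zone (j : nat) : {set T} :=
  if j is j'.+1 then x j'.*2.+1 |: (B j'.*2 :|: B j'.*2.+1 :|: zone j')
  else set0.

Lemma zone_V j z : j.*2 <= p -> z \in zone j -> z \in V.
Proof.
elim: j => [|j IH] jp; first by rewrite inE.
rewrite !inE => /or3P[/eqP->|/orP[]|/IH->//]; first exact: (frame_x F _).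
  by apply: (frame_B F _); lia.
by apply: (frame_B F _); lia.
lia.
Qed.

Lemma zone_B j i z : j.*2 <= i -> i < p -> z \in B i -> z \notin zone j.
Proof.
move=> ji ip zi; elim: j ji => [|j IH] ji; first by rewrite inE.
rewrite !inE !negb_or IH ?andbT; last lia.
apply/and3P; split; apply/negP.
- move=> /eqP e; move: (frame_xB F (i := j.*2.+1) (j := i)).
  by rewrite -e zi => /(_ _ ip); lia.
- by move=> /(fun h => frame_BB F _ ip h zi); lia.
- by move=> /(fun h => frame_BB F _ ip h zi); lia.
Qed.

Lemma zone_x j i :
  j.*2 <= p -> i < p -> (j.*2 <= i) || ~~ odd i -> x i \notin zone j.
Proof.
move=> jp ip; elim: j jp => [|j IH] jp ji; first by rewrite inE.
rewrite !inE !negb_or IH ?andbT; [|lia|lia].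
rewrite !(frame_xB F) ?andbT; try lia.
by apply/eqP=> /(frame_inj F ip); lia.
Qed.

(** A path of [Q] that ends at a vertex [w] outside the cycle is prolonged by
    [2j] edges: the edges [2i] and [2i + 1] of the cycle keep their common joint
    and have their other joints replaced by vertices outside. One new outside
    vertex pays for two edges. Here [A] is the stock of unused outside vertices,
    of which [A'] is left. *)
Lemma zigzag j U n u w A :
  j.*2 <= p -> lpath k Q U n u w -> w \notin V ->
  (forall z, z \in A -> z \notin V) -> (forall z, z \in A -> z \notin U) ->
  (forall z, z \in zone j -> z \notin U) -> j <= #|A| ->
  exists U' w' A', [/\ lpath k Q U' (n + j.*2) u w', w' \notin V,
    {subset A' <= A} /\ #|A'| + j = #|A|, forall z, z \in A' -> z \notin U'
    & forall z, z \in U' -> [|| z \in U, z \in A | z \in zone j]].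
Proof.
elim: j => [|j IH] jp P wV AV AU ZU jA.
  exists U, w, A; split; rewrite ?addn0 //; first by split.
  by move=> z ->.
have [|||U' [w' [A' [P' wV' [sA cA] AU' U'E]]]] := IH _ P wV AV AU; try lia.
  by move=> z zj; apply: ZU; rewrite !inE zj !orbT.
have [a aA'] : exists a, a \in A' by apply/set0Pn; rewrite -card_gt0; lia.
have aV : a \notin V by apply/AV/sA.
have e1 : j.*2 < p by lia.
have e2 : j.*2.+1 < p by lia.
have out z : z \in V -> z \in zone j.+1 -> z \notin zone j -> z \notin U'.
  move=> zV zj zj'; apply/negP=> /U'E; rewrite (negPf (ZU _ zj)) (negPf zj') orbF /=.
  by move/AV/negP.
have B1 z : z \in B j.*2 -> z \notin U'.
  move=> zB; apply: out; first exact: (frame_B F _ zB).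
    by rewrite !inE zB orbT.
  exact: (zone_B _ _ zB).
have B2 z : z \in B j.*2.+1 -> z \notin U'.
  move=> zB; apply: out; first exact: (frame_B F _ zB).
    by rewrite !inE zB !orbT.
  by apply: (zone_B _ _ zB); lia.
have xV := frame_x F j.*2.+1.
have Bn i : i < p -> a \notin B i.
  by move=> ip; apply: contraNN aV; apply: (frame_B F _).
exists (a |: (x j.*2.+1 |: (B j.*2 :|: B j.*2.+1 :|: U'))), a, (A' :\ a).
split=> //.
- rewrite doubleS !addnS; apply: (lpath_step2 P') => //.
  + split=> //.
    * move=> z z1; apply/negP=> z2; have := frame_BB F e1 e2 z1 z2; lia.
    * rewrite !inE !negb_or !(frame_xB F) ?andbT //; apply: out => //.
        by rewrite !inE eqxx.
      by apply: zone_x => //; lia.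
    * rewrite !inE !negb_or !Bn ?andbT //; apply/andP; split; last exact: AU'.
      by apply: contraNneq aV => ->.
  + exact: (frame_card F _).
  + exact: (frame_card F _).
  + exact: (frame_Qblock e1 wV').2.
  + exact: (frame_Qblock e2 aV).1.
- split; first by move=> z /setD1P[_ /sA].
  by have := cardsD1 a A'; rewrite aA'; lia.
- move=> z /setD1P[za zA]; have zV := AV _ (sA _ zA).
  have nB i : i < p -> z \notin B i.
    by move=> ip; apply: contraNN zV; apply: (frame_B F _).
  rewrite !inE !negb_or za !nB ?AU' ?andbT //.
  by apply: contraNneq zV => ->.
- move=> z; rewrite [zone _]/= !inE.
  case/orP=> [/eqP->|]; first by rewrite (sA _ aA') orbT.
  case/or3P=> [->|->|/U'E/or3P[]->]; by rewrite ?orbT.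
Qed.

(** As [zigzag], but with interiors taken from the outside vertices. Any joint
    may sit in the middle of such a pair, and those with even index are the ones
    that [zigzag] leaves free. A pair spends [2k - 3] outside vertices: two
    interiors and a new end. *)
Lemma outer_zigzag h U n u w A :
  (forall i, i < h -> i.*2 < p /\ x i.*2 \notin U) ->
  lpath k Q U n u w -> w \notin V ->
  (forall z, z \in A -> z \notin V) -> (forall z, z \in A -> z \notin U) ->
  h * (2 * k - 3) <= #|A| ->
  exists U' w' A', [/\ lpath k Q U' (n + h.*2) u w', w' \notin V,
    {subset A' <= A} /\ #|A'| + h * (2 * k - 3) = #|A|,
    forall z, z \in A' -> z \notin U'
    & forall z, z \in U' ->
        [\/ z \in U, z \in A | exists2 i, i < h & z = x i.*2]].
Proof.
elim: h => [|h IH] hx P wV AV AU hA.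
  exists U, w, A; split; rewrite ?addn0 ?mul0n ?addn0 //; first by split.
  by move=> z zU; apply: Or31.
have [||U' [w' [A' [P' wV' [sA cA] AU' U'E]]]] := IH _ P wV AV AU.
- by move=> i ih; apply: hx; lia.
- by move: hA; rewrite mulSn; lia.
have [hp xU] := hx h (ltnSn h).
have [D sD cD] : exists2 D : {set T}, {subset D <= A'} & #|D| = 2 * k - 3.
  by apply: exists_subset; move: hA; rewrite mulSn; lia.
have [D1 sD1 cD1] : exists2 D1 : {set T}, {subset D1 <= D} & #|D1| = k - 2.
  by apply: exists_subset; lia.
have cD' : #|D :\: D1| = k - 1.
  by rewrite cardsD (setIidPr _) ?cD ?cD1; [lia | apply/subsetP].
have [a aD'] : exists a, a \in D :\: D1 by apply/set0Pn; rewrite -card_gt0; lia.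
pose D2 := (D :\: D1) :\ a.
have cD2 : #|D2| = k - 2 by have := cardsD1 a (D :\: D1); rewrite aD' -/D2; lia.
have [aD aD1] : a \in D /\ a \notin D1 by move: aD'; rewrite inE => /andP[].
have DV z : z \in D -> z \notin V by move=> /sD/sA/AV.
have DU z : z \in D -> z \notin U' by move=> /sD/AU'.
have D2D z : z \in D2 -> z \in D by rewrite !inE => /and3P[].
have xV := frame_x F h.*2.
have xD : x h.*2 \notin D by apply: contraTN xV => /DV.
have xU' : x h.*2 \notin U'.
  apply/negP=> /U'E[|/AV|[i ih]].
  - by rewrite (negPf xU).
  - by rewrite xV.
  - by move/(frame_inj F hp); lia.
exists (a |: (x h.*2 |: (D1 :|: D2 :|: U'))), a, (A' :\: D).
split.
- rewrite doubleS !addnS; apply: (lpath_step2 P') => //.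
  + split; [by move=> z /sD1/DU | by move=> z /D2D/DU| | |].
    * by move=> z z1; rewrite !inE z1 andbF.
    * rewrite !inE !negb_or xU' (contraNN (@sD1 _) xD) (negPf xD) //=.
      by rewrite !andbF.
    * rewrite !inE !negb_or (DU _ aD) aD1 eqxx ?andbT /=.
      by apply: contraNneq (DV _ aD) => ->.
  + apply: frame_Qout => //; last by move=> z /setU1P[->|/sD1/DV].
    rewrite cardsU1 cD1 (contraTN _ (lpath_ends P').2); [lia|].
    by move=> /sD1/DU.
  + apply: frame_Qout => //; last by move=> z /setU1P[->|/D2D/DV]//; exact: DV.
    by rewrite cardsU1 cD2 !inE eqxx /=; lia.
- exact: DV.
- split; first by move=> z /setDP[/sA].
  have sub : D \subset A' by apply/subsetP.
  have := cardsD A' D; rewrite (setIidPr sub) cD.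
  by have := subset_leq_card sub; rewrite cD mulSn; lia.
- move=> z /setDP[zA zD].
  rewrite !inE !negb_or (AU' _ zA) (contraNN (@sD1 _) zD) (negPf zD) //=.
  rewrite !andbF !andbT; apply/andP; split; first by apply: contraNneq zD => ->.
  by apply: contraTneq (AV _ (sA _ zA)) => ->; rewrite xV.
- move=> z; rewrite in_setU1 => /orP[/eqP->|]; first by apply/Or32/sA/sD.
  rewrite in_setU1 => /orP[/eqP->|]; first by apply: Or33; exists h.
  rewrite !in_setU => /orP[/orP[/sD1|/D2D]|].
  + by move=> /sD/sA; apply: Or32.
  + by move=> /sD/sA; apply: Or32.
  + move=> /U'E[zU|zA|[i ih ->]]; [exact: Or31|exact: Or32|].
    by apply: Or33; exists i => //; lia.
Qed.

(** Each pair of [outer_zigzag] spends one outside vertex less than [k - 1] per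
    edge, and so does an odd last edge, which may end at a joint; this saving
    accounts for the successor in the bound. *)
Lemma outer_tail d U n u w A :
  d <= p -> (forall i, i.*2 < d -> x i.*2 \notin U) ->
  lpath k Q U n u w -> w \notin V ->
  (forall z, z \in A -> z \notin V) -> (forall z, z \in A -> z \notin U) ->
  d * (k - 1) <= #|A|.+1 ->
  exists U' v, lpath k Q U' (n + d) u v.
Proof.
move=> dp xU P wV AV AU dA.
have [->|d0] := posnP d; first by exists U, w; rewrite addn0.
have dE := odd_double_half d; set h := d./2 in dE.
have c2 : (2 * k - 3) = (k - 1) + (k - 1) - 1 by lia.
have [||U' [w' [A' [P' wV' [sA cA] AU' U'E]]]] :=
  @outer_zigzag h U n u w A _ P wV AV AU.
- by move=> i ih; split; [lia | apply: xU; lia].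
- by rewrite c2; nia.
case: (odd d) dE => /= dE; last by exists U', w'; rewrite -dE add0n.
have hd : h.*2 < d by lia.
have [D sD cD] : exists2 D : {set T}, {subset D <= A'} & #|D| = k - 2.
  by apply: exists_subset; move: cA; rewrite c2; nia.
have xV := frame_x F h.*2.
have DV z : z \in D -> z \notin V by move=> /sD/sA/AV.
have xD : x h.*2 \notin D by apply: contraTN xV => /DV.
have xU' : x h.*2 \notin U'.
  apply/negP=> /U'E[|/AV|[i ih]].
  - by rewrite (negPf (xU _ _)).
  - by rewrite xV.
  - by move/(frame_inj F (i := h.*2)); lia.
exists ((x h.*2 |: D) :|: U'), (x h.*2).
rewrite -dE add1n addnS; apply: (lpath_step P').
- by move=> z /setU1P[->//|/sD/AU'].
- by rewrite cardsU1 xD cD; lia.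
- exact: setU11.
- rewrite setUCA; apply: frame_Qout; [lia| |by move=> z /setU1P[->//|/DV]].
  rewrite cardsU1 cD (contraTN _ (lpath_ends P').2); [lia|].
  by move=> /sD/AU'.
Qed.


Lemma zone_uncovered j w z :
  j.*2 <= p -> w \notin V -> z \in zone j -> z \notin [set w].
Proof.
by move=> jp wV /(zone_V jp) zV; rewrite inE; apply: contraNneq wV => <-.
Qed.

(** [zigzag] closes up to a cycle. For even [m] its last two edges use the free
    edges [m - 2] and [m - 1] of the frame and return to the first outside
    vertex. For odd [m] the last edge joins the first and the last outside
    vertex through [x (m - 1)] and [B (m - 1)], whose interior gives up one
    vertex because two outside vertices take part. *)
Lemma frame_cycle m : 2 < m -> m <= p -> (m + 1) %/ 2 <= #|~: V| ->
  copy_in Q setT (loose_cycle k m).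
Proof.
move=> m2 mp mV.
have [w0 w0V] : exists w0, w0 \in ~: V by apply/set0Pn; rewrite -card_gt0; lia.
have w0V' : w0 \notin V by rewrite inE in w0V.
pose A := ~: V :\ w0.
have cA : #|~: V| = #|A|.+1 by rewrite (cardsD1 w0) w0V.
have AV z : z \in A -> z \notin V by rewrite !inE => /andP[].
have A0 z : z \in A -> z \notin [set w0] by rewrite !inE => /andP[].
have Aw : A \subset ~: V by apply/subsetP=> z; rewrite !inE => /andP[].
have inV (j : nat) (U' : {set T}) z : j.*2 <= p ->
    (forall z, z \in U' -> [|| z \in [set w0], z \in A | z \in zone j]) ->
    z \in V -> z \notin zone j -> z \notin U'.
  move=> jp U'E zV zj; apply/negP=> /U'E; rewrite (negPf zj) orbF inE.
  by case/orP=> [/eqP e|/AV]; [move: w0V'; rewrite -e zV | rewrite zV].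
have [j [mj|mj]] : exists j, m = j.*2.+2 \/ m = j.*2.+1 by exists (m.-1)./2; lia.
  have [|||U' [w' [A' [P' wV' _ _ U'E]]]] :=
    zigzag (j := j) _ (lpath_point k Q w0) w0V' AV A0.
  - lia.
  - by move=> z; apply: zone_uncovered => //; lia.
  - lia.
  have e1 : j.*2 < p by lia.
  have e2 : j.*2.+1 < p by lia.
  have jp := ltnW e1.
  have new := inV j U' _ jp U'E.
  have P'' : lpath k Q ((x j.*2.+1 |: B j.*2) :|: U') j.*2.+1 w0 (x j.*2.+1).
    apply: (lpath_step P').
    - move=> z /setU1P[->|zB]; apply: new.
      + exact: (frame_x F).
      + by apply: zone_x => //; lia.
      + exact: (frame_B F _ zB).
      + exact: (zone_B _ _ zB).
    - by rewrite cardsU1 (frame_xB F) // (frame_card F) //; lia.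
    - exact: setU11.
    - by rewrite setUCA; apply: (frame_Qblock e1 wV').2.
  rewrite mj; apply: (copy_in_sub (subsetT _)).
  apply: (lpath_close_copy k1 _ P'') => //.
  - move=> z zB; have zV := frame_B F e2 zB.
    rewrite !inE !negb_or new ?andbT //; last by apply: (zone_B _ _ zB); lia.
    apply/andP; split; first by apply: contraTneq zB => ->; apply: (frame_xB F).
    by apply/negP=> /(frame_BB F e2 e1 zB); lia.
  - exact: (frame_card F).
  - by rewrite setUCA; apply: (frame_Qblock e2 w0V').1.
have [|||U' [w' [A' [P' wV' _ _ U'E]]]] :=
    zigzag (j := j) _ (lpath_point k Q w0) w0V' AV A0.
- lia.
- by move=> z; apply: zone_uncovered => //; lia.
- lia.
have e1 : j.*2 < p by lia.
have jp := ltnW e1.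
have new := inV j U' _ jp U'E.
have ww : w0 != w' by apply: (lpath_neq _ P'); lia.
have [b bB] : exists b, b \in B j.*2.
  by apply/set0Pn; rewrite -card_gt0 (frame_card F e1); lia.
have cB : #|B j.*2 :\ b| = k - 3.
  by have := cardsD1 b (B j.*2); rewrite bB (frame_card F e1); lia.
have wB w : w \notin V -> w \notin B j.*2 :\ b.
  by move=> wV; apply: contraNN wV => /setD1P[_]; apply: (frame_B F _).
rewrite mj; apply: (copy_in_sub (subsetT _)).
apply: (@lpath_close_copy _ _ _ _ _ _ _ (x j.*2 |: B j.*2 :\ b) k1 _ P').
- lia.
- move=> z /setU1P[->|/setD1P[_ zB]]; apply: new.
  + exact: (frame_x F).
  + by apply: zone_x => //; lia.
  + exact: (frame_B F _ zB).
  + exact: (zone_B _ _ zB).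
- rewrite cardsU1 cB inE (negPf (frame_xB F _ _)) // andbF; lia.
- rewrite (_ : _ |: _ = x j.*2 |: (w0 |: (w' |: B j.*2 :\ b))); last first.
    by rewrite [w' |: (x _ |: _)]setUCA setUCA.
  apply: (frame_Q F e1 _ _).1.
    rewrite !cardsU1 cB !(wB w') // in_setU1 (negPf ww) (negPf (wB w0 _)) //=; lia.
  move=> z /setU1P[->|/setU1P[->|/setD1P[_ zB]]]; by [left|right].
Qed.

(** A path of [Q] outside the cycle is prolonged by all [p] edges of the cycle.
    For odd [p] all of them are attached at one end. For even [p] that would
    need one outside vertex too many, so one edge is attached at the start and
    the odd number [p - 1] of others at the end. *)
Lemma frame_attach d U u v : 0 < p ->
  lpath k Q U d u v -> (forall z, z \in U -> z \notin V) ->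
  (p + 1) %/ 2 <= #|~: (V :|: U)|.+1 ->
  exists U' u' v', lpath k Q U' (d + p) u' v'.
Proof.
move=> p0 P UV pA; pose A := ~: (V :|: U).
have AV z : z \in A -> z \notin V by rewrite !inE negb_or => /andP[].
have AU z : z \in A -> z \notin U by rewrite !inE negb_or => /andP[].
have [uU vU] := lpath_ends P.
have [j [pj|pj]] : exists j, p = j.*2.+2 \/ p = j.*2.+1 by exists (p.-1)./2; lia.
  have e1 : j.*2 < p by lia.
  have e2 : j.*2.+1 < p by lia.
  have xpB : x p \notin B j.*2.+1 by rewrite (frame_close F) (frame_xB F).
  have P1 : lpath k Q ((x p |: B j.*2.+1) :|: U) d.+1 (x p) v.
    apply: (lpath_prepend P).
    - move=> z /setU1P[->|zB]; apply: contraTN (frame_x F p) => zU.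
        exact: UV zU.
      by have /negP[] := UV _ zU; apply: (frame_B F _ zB).
    - by rewrite cardsU1 xpB (frame_card F) //; lia.
    - exact: setU11.
    - rewrite setUCA; have := (frame_Qblock e2 (UV _ uU)).2.
      by rewrite (_ : j.*2.+2 = p).
  have xpV := frame_x F p.
  have zV z : z \in zone j -> z \in V by apply: zone_V; lia.
  have [||||U' [w' [A' [P' wV' _ _ U'E]]]] := zigzag (j := j) _ P1 (UV _ vU) AV.
  - lia.
  - move=> z zA; have zV' := AV _ zA; rewrite !inE !negb_or AU // andbT.
    apply/andP; split; first by apply: contraNneq zV' => ->.
    by apply: contraNN zV'; apply: (frame_B F _).
  - move=> z zj; rewrite !inE !negb_or; apply/andP; split; last first.
      by apply: contraTN (zV _ zj) => /UV.
    apply/andP; split; apply: contraTN zj.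
      by move/eqP->; rewrite (frame_close F); apply: zone_x; lia.
    by move=> zB; apply: (zone_B _ _ zB); lia.
  - by rewrite /A; lia.
  exists ((x j.*2.+1 |: B j.*2) :|: U'), (x p), (x j.*2.+1).
  rewrite (_ : d + p = (d.+1 + j.*2).+1); last lia.
  apply: (lpath_step P').
  - move=> z zS; have zV' : z \in V.
      by case/setU1P: zS => [->|/(frame_B F _)]; [apply: (frame_x F)|apply].
    have zj : z \notin zone j.
      case/setU1P: zS => [->|zB]; last exact: (zone_B _ _ zB).
      by apply: zone_x; lia.
    apply/negP=> /U'E/or3P[|/AV|]; [|by rewrite zV'|by rewrite (negPf zj)].
    rewrite !inE => /orP[/orP[]|/UV]; last by rewrite zV'.
      move/eqP=> e; case/setU1P: zS.
        by rewrite e (frame_close F) => /(frame_inj F p0 e2).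
      by rewrite e (frame_close F) (negPf (frame_xB F _ _)).
    case/setU1P: zS => [->|zB]; first by rewrite (negPf (frame_xB F _ _)).
    by move/(frame_BB F e1 e2 zB); lia.
  - by rewrite cardsU1 (frame_xB F) // (frame_card F) //; lia.
  - exact: setU11.
  - by rewrite setUCA; apply: (frame_Qblock e1 wV').2.
have e1 : j.*2 < p by lia.
have zV z : z \in zone j -> z \in V by apply: zone_V; lia.
have [|||U' [w' [A' [P' wV' _ _ U'E]]]] := zigzag (j := j) _ P (UV _ vU) AV AU.
- lia.
- by move=> z /zV; apply: contraTN => /UV.
- by rewrite /A; lia.
exists ((x j.*2 |: B j.*2) :|: U'), u, (x j.*2).
rewrite pj addnS; apply: (lpath_step P').
- move=> z zS; have zV' : z \in V.
    by case/setU1P: zS => [->|/(frame_B F _)]; [apply: (frame_x F)|apply].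
  have zj : z \notin zone j.
    case/setU1P: zS => [->|zB]; last exact: (zone_B _ _ zB).
    by apply: zone_x; lia.
  by apply/negP=> /U'E/or3P[/UV|/AV|]; rewrite ?zV' ?(negPf zj).
- by rewrite cardsU1 (frame_xB F) // (frame_card F) //; lia.
- exact: setU11.
- by rewrite setUCA; apply: (frame_Qblock e1 wV').1.
Qed.

(** For [d < p] the joints with even index suffice as middle points of the [d]
    additional edges. For odd [p] the unpaired last edge of the cycle is paired
    with the first of the additional ones. *)
Lemma frame_long_path d : 0 < d -> d < p ->
  d * (k - 1) + (p + 1) %/ 2 <= #|~: V| ->
  exists U u v, lpath k Q U (d + p) u v.
Proof.
move=> d0 dp dV.
have dk : 0 < d * (k - 1) by rewrite muln_gt0 d0 subn_gt0.
have [w0 w0V] : exists w0, w0 \in ~: V by apply/set0Pn; rewrite -card_gt0; lia.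
have w0V' : w0 \notin V by rewrite inE in w0V.
pose A := ~: V :\ w0.
have cA : #|~: V| = #|A|.+1 by rewrite (cardsD1 w0) w0V.
have AV z : z \in A -> z \notin V by rewrite !inE => /andP[].
have A0 z : z \in A -> z \notin [set w0] by rewrite !inE => /andP[].
pose h := p./2.
have hp : h.*2 <= p by rewrite /h; lia.
have [||U' [w' [A' [P' wV' [sA cA'] AU' U'E]]]] :=
  zigzag hp (lpath_point k Q w0) w0V' AV A0.
- by move=> z; apply: zone_uncovered.
- rewrite /h; lia.
have new z : z \in V -> z \notin zone h -> z \notin U'.
  move=> zV zj; apply/negP=> /U'E; rewrite (negPf zj) orbF inE.
  by case/orP=> [/eqP e|/AV]; [move: w0V'; rewrite -e zV | rewrite zV].
have xnew i : i < p -> ~~ odd i -> x i \notin U'.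
  by move=> ip io; apply: new; [apply: (frame_x F)|apply: zone_x; rewrite ?io ?orbT].
have A'V z : z \in A' -> z \notin V by move/sA/AV.
case: (boolP (odd p)) => podd; last first.
  have [||U'' [v P'']] := outer_tail (d := d) (ltnW dp) _ P' wV' A'V AU'.
  - by move=> i id; apply: xnew; rewrite ?odd_double; lia.
  - by move: cA'; rewrite /h; lia.
  by exists U'', w0, v; rewrite (_ : d + p = 0 + h.*2 + d) // /h; lia.
have [D sD cD] : exists2 D : {set T}, {subset D <= A'} & #|D| = k - 1.
  by apply: exists_subset; move: cA'; rewrite /h; nia.
have [a aD] : exists a, a \in D by apply/set0Pn; rewrite -card_gt0; lia.
have cDa : #|D :\ a| = k - 2 by have := cardsD1 a D; rewrite aD; lia.
have e1 : h.*2 < p by rewrite /h; lia.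
have aV := A'V _ (sD _ aD).
have xV := frame_x F h.*2.
have xD : x h.*2 \notin D by apply: contraTN xV => /sD/A'V.
pose A1 := A' :\: D.
have cA1 : #|A1| + (k - 1) = #|A'|.
  have sub : D \subset A' by apply/subsetP.
  have := cardsD A' D; rewrite (setIidPr sub) cD -/A1.
  by have := subset_leq_card sub; rewrite cD; lia.
have P1 : lpath k Q (a |: (x h.*2 |: (B h.*2 :|: (D :\ a) :|: U')))
    (0 + h.*2).+2 w0 a.
  apply: (lpath_step2 P') => //.
  - split.
    + move=> z zB; apply: new; first exact: (frame_B F _ zB).
      exact: (zone_B _ _ zB).
    + by move=> z /setD1P[_ /sD/AU'].
    + move=> z zB; rewrite inE negb_and; apply/orP; right.
      by apply: contraTN (frame_B F e1 zB) => /sD/A'V.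
    + rewrite !inE !negb_or (frame_xB F) // andbT xnew ?odd_double //=.
      by rewrite negb_and xD orbT.
    + rewrite !inE !negb_or eqxx andbT (AU' _ (sD _ aD)) /=.
      apply/andP; split; first by apply: contraNneq aV => ->.
      by apply: contraNN aV; apply: (frame_B F _).
  - exact: (frame_card F).
  - exact: (frame_Qblock e1 wV').1.
  - by apply: frame_Qout; rewrite ?setD1K // => z /sD/A'V.
have [|||||U'' [v P'']] := outer_tail (d := d - 1) (A := A1) _ _ P1 aV.
- lia.
- move=> i id; have ip : i.*2 < p by lia.
  have xiV := frame_x F i.*2.
  have xa : x i.*2 != a by apply: contraTneq xiV => ->.
  have xh : x i.*2 != x h.*2.
    by apply/eqP=> /(frame_inj F ip e1); rewrite /h; lia.
  have xiD : x i.*2 \notin D by apply: contraTN xiV => /sD/A'V.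
  by rewrite !inE !negb_or xa xh (negPf xiD) (frame_xB F) // xnew ?odd_double ?andbF.
- by move=> z /setDP[/A'V].
- move=> z /setDP[zA zD]; have zV := A'V _ zA.
  have za : z != a by apply: contraNneq zD => ->.
  have zx : z != x h.*2 by apply: contraNneq zV => ->.
  have zB : z \notin B h.*2 by apply: contraNN zV; apply: (frame_B F _).
  by rewrite !inE !negb_or za zx zB (negPf zD) andbF AU'.
- by move: cA'; rewrite mulnBl mul1n /h; lia.
by exists U'', w0, v; rewrite (_ : d + p = (0 + h.*2).+2 + (d - 1)) // /h; lia.
Qed.

End Frame.

(** * Transfer between Ramsey numbers and colourings of subsets *)

(** Between finite vertex sets there are finitely many maps to inspect. *)
Lemma copy_in_dec (T : finType) (Q : {set T} -> bool) (W : {set T}) G :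
  copy_in Q W G \/ ~ copy_in Q W G.
Proof.
pose good (f : {ffun vertex G -> T}) :=
  [&& injectiveb f, [forall t, f t \in W] & [forall e in edges G, Q (f @: e)]].
case: (boolP [exists f, good f]) => [/existsP[f /and3P[/injectiveP fi fW fQ]]|no].
  by left; exists f; split=> // [|e eG]; [apply/forallP|apply: (forall_inP fQ)].
right=> -[f [fi fW fQ]]; move/negP: no; apply; apply/existsP; exists (finfun f).
apply/and3P; split.
- by apply/injectiveP=> a b; rewrite !ffunE => /fi.
- by apply/forallP=> t; rewrite ffunE.
- apply/forall_inP=> e /fQ; congr Q; apply: eq_imset => t.
  by rewrite ffunE.
Qed.

(** A Ramsey property applies inside every large enough vertex subset, by
    pulling the colouring back along an enumeration of the subset. *)
Lemma arrows_copy_in k M G H (T : finType) (W : {set T}) (c : {set T} -> bool) :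
  ramsey_arrows k M G H -> M <= #|W| ->
  copy_in c W G \/ copy_in (fun e => ~~ c e) W H.
Proof.
move=> arr MW; pose h (i : 'I_M) := enum_val (widen_ord MW i).
have hi : injective h by move=> i j /enum_val_inj/(congr1 val)/= /val_inj.
have hW i : h i \in W by apply: enum_valP.
have tr b K :
    contains_copy (@colour_class (complete k M) (fun e => c (h @: e)) b) K ->
    copy_in (fun e => c e == b) W K.
  case=> f [fi fQ]; exists (h \o f); split=> [|t|e /fQ].
  - exact: (inj_comp hi fi).
  - exact: hW.
  - by case/setIdP=> _ h1; rewrite imset_comp.
case: (arr (fun e => c (h @: e))) => /tr [f [fi fW fQ]].
  by left; exists f; split=> // e /fQ /eqP.
by right; exists f; split=> // e /fQ /eqP ->.
Qed.

Lemma copy_in_arrows k N G H : uniform k G -> uniform k H ->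
  (forall c : {set 'I_N} -> bool,
     copy_in c setT G \/ copy_in (fun e => ~~ c e) setT H) ->
  ramsey_arrows k N G H.
Proof.
move=> uG uH hc c; case: (hc c) => -[f [fi _ fQ]]; [left|right];
  exists f; split=> // e eE; rewrite !inE card_imset //.
  by rewrite uG // eqxx; apply/eqP/fQ.
by rewrite uH // eqxx; apply/eqP/negbTE/fQ.
Qed.

(** * Lower bounds *)

Lemma card_ord_below M a : #|[set v : 'I_M | v < a]| = minn a M.
Proof.
case: (leqP a M) => aM; last first.
  rewrite (_ : [set _ | _] = setT) ?cardsT ?card_ord //.
  by apply/setP=> v; rewrite !inE; have := ltn_ord v; lia.
by rewrite cardsE -sum1_card -(big_ord_widen M (fun=> 1)) // sum1_card card_ord.
Qed.

(** Double counting of the incidences between [K] and the edges. *)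
Lemma leq_cover_degree2 (V : finType) m (E : 'I_m -> {set V}) (K : {set V}) :
  (forall v, #|[set i | v \in E i]| <= 2) ->
  (forall i, exists2 v, v \in K & v \in E i) -> m <= 2 * #|K|.
Proof.
move=> deg cov; rewrite -[X in X <= _]card_ord -[X in X <= _]sum1_card.
apply: (@leq_trans (\sum_i \sum_(v in K) (v \in E i))).
  apply: leq_sum => i _; have [v vK vi] := cov i.
  by rewrite (bigD1 v) //= vi.
rewrite exchange_big mulnC -sum_nat_const /=; apply: leq_sum => v _.
by rewrite -big_mkcond sum1dep_card.
Qed.

Lemma card_ord_le2 m (A : {set 'I_m}) q q' :
  (forall i, i \in A -> i = q :> nat \/ i = q' :> nat) -> #|A| <= 2.
Proof.
move=> Aq; rewrite leqNgt; apply/negP=> /card_gt2P[a [b [c [[aA bA cA]]]]].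
have := Aq a aA; have := Aq b bA; have := Aq c cA.
by rewrite -!val_eqE /= => h1 h2 h3 [h4 h5 h6]; lia.
Qed.

Lemma loose_path_degree k n v : 1 < k ->
  #|[set i : 'I_n | v \in loose_path_edge k i]| <= 2.
Proof.
move=> k1; apply: (@card_ord_le2 _ _ (v %/ (k - 1)) (v %/ (k - 1)).-1) => i.
rewrite !inE => /existsP[j /eqP /= ->]; have k0 : 0 < k - 1 by lia.
rewrite divnMDl //; have [jk|jk] := ltnP j (k - 1).
  by left; rewrite divn_small ?addn0.
have -> : j = k - 1 :> nat by have := ltn_ord j; lia.
by right; rewrite divnn k0; lia.
Qed.

Lemma loose_cycle_degree k n v : 1 < k ->
  #|[set i : 'I_n | v \in loose_cycle_edge k i]| <= 2.
Proof.
move=> k1; pose q := v %/ (k - 1).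
apply: (@card_ord_le2 _ _ q (if q == 0 then n - 1 else q - 1)) => i.
rewrite !inE => /existsP[j /eqP /= vE]; have k0 : 0 < k - 1 by lia.
have iL := ltn_ord i.
rewrite {}/q vE; have [jk|jk] := ltnP j (k - 1).
  left; rewrite modn_small ?divnMDl ?divn_small ?addn0 //.
  by nia.
have -> : j = k - 1 :> nat by have := ltn_ord j; lia.
right; rewrite addnC -mulSn -muln_modl mulnK //.
have [e|e] := eqVneq i.+1 n; first by rewrite e modnn eqxx; lia.
by rewrite modn_small ?subn1 /=; lia.
Qed.

(** Colour red the edges inside a set of [(k - 1) * n] vertices. This set is one
    vertex too small for the path, whereas the fewer than [t] other vertices
    meet every blue edge and cannot cover a copy of [H]. *)
Lemma path_lower_bound k n M t H :
  1 < k -> 0 < n -> 0 < t ->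
  (forall K : {set vertex H},
     (forall e, e \in edges H -> exists2 v, v \in K & v \in e) -> t <= #|K|) ->
  ramsey_arrows k M (loose_path k n) H -> (k - 1) * n + t <= M.
Proof.
move=> k1 n0 t0 cov arr; rewrite leqNgt; apply/negP=> Mlt.
pose a := (k - 1) * n.
pose A := [set v : 'I_M | v < a].
have cA : #|A| = minn a M by apply: card_ord_below.
have cA' : #|A| + #|~: A| = M by rewrite cardsC card_ord.
case: (arr (fun e => e \subset A)) => -[f [fi fQ]].
  have fA v : f v \in A.
    have k0 : 0 < k - 1 by lia.
    have /= vn := ltn_ord v.
    (* The last vertex starts no edge, hence the minimum. *)
    pose i := minn (v %/ (k - 1)) n.-1.
    have lin : i < n by rewrite /i; lia.
    have /fQ : loose_path_edge k (Ordinal lin) \in edges (loose_path k n).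
      by apply/imsetP; exists (Ordinal lin).
    rewrite inE => /andP[_ /eqP/subsetP]; apply; apply: imset_f.
    rewrite inE /=.
    have v1 := divn_eq v (k - 1); have v2 := ltn_pmod v k0.
    have jk : v - i * (k - 1) < k.
      rewrite /i; case: (leqP (v %/ (k - 1)) n.-1) => h; first lia.
      have : n = n.-1 + 1 by lia.
      by move: vn; nia.
    apply/existsP; exists (Ordinal jk) => /=; apply/eqP; rewrite subnKC //.
    by rewrite [X in _ <= X]v1 (leq_trans _ (leq_addr _ _)) // leq_mul2r /i; lia.
  have : #|[set f v | v in [set: 'I_(n * (k - 1) + 1)]]| <= #|A|.
    by apply/subset_leq_card/subsetP=> _ /imsetP[v _ ->]; apply: fA.
  by rewrite card_imset // cardsT card_ord cA; lia.
have := cov (f @^-1: ~: A) _; rewrite leqNgt => /(_ _)/negP[].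
  move=> e /fQ; rewrite inE => /andP[_ /eqP/negbT/subsetPn[_ /imsetP[v ve ->]]].
  by move=> vA; exists v; rewrite // !inE in vA *.
rewrite -(card_imset _ fi); apply: (@leq_ltn_trans #|~: A|); last by lia.
by apply/subset_leq_card/subsetP=> _ /imsetP[v + ->]; rewrite inE.
Qed.

Lemma path_path_lower_bound k n m M : 1 < k -> 0 < n -> 0 < m ->
  ramsey_arrows k M (loose_path k n) (loose_path k m) ->
  (k - 1) * n + (m + 1) %/ 2 <= M.
Proof.
move=> k1 n0 m0; apply: path_lower_bound => // [|K cov]; first lia.
suff : m <= 2 * #|K| by lia.
apply: (@leq_cover_degree2 _ _ (loose_path_edge k (n := m))) => [v|i].
  exact: loose_path_degree.
by apply: cov; apply/imsetP; exists i.
Qed.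

Lemma path_cycle_lower_bound k n m M : 1 < k -> 0 < n -> 0 < m ->
  ramsey_arrows k M (loose_path k n) (loose_cycle k m) ->
  (k - 1) * n + (m + 1) %/ 2 <= M.
Proof.
move=> k1 n0 m0; apply: path_lower_bound => // [|K cov]; first lia.
suff : m <= 2 * #|K| by lia.
apply: (@leq_cover_degree2 _ _ (loose_cycle_edge k (n := m))) => [v|i].
  exact: loose_cycle_degree.
by apply: cov; apply/imsetP; exists i.
Qed.

(** * Upper bounds *)

(** The formula for two cycles leaves one vertex to spare. It yields a blue
    [C_m] or a red [C_n]; in the latter case, unless there is a red [P_n],
    exactly [(m + 1) %/ 2] vertices lie outside the red cycle, as many as a blue
    [C_m] needs. *)
Lemma path_cycle_arrows k n m : 2 < k -> 2 < m -> m <= n ->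
  ramsey_arrows k ((k - 1) * n + (m - 1) %/ 2) (loose_cycle k n) (loose_cycle k m) ->
  ramsey_arrows k ((k - 1) * n + (m + 1) %/ 2) (loose_path k n) (loose_cycle k m).
Proof.
move=> k2 m2 mn arr; apply: copy_in_arrows => [||c].
- by apply: loose_path_uniform; lia.
- by apply: loose_cycle_uniform; lia.
have [redP|noP] := copy_in_dec c setT (loose_path k n); first by left.
have [|redC|] := @arrows_copy_in _ _ _ _ _ setT c arr.
- by rewrite cardsT card_ord; lia.
- have n1 : 1 < n by lia.
  have [V [x [B [F cV]]]] :=
    cycle_frame (Q := fun e => ~~ c e) k2 n1 (fun e h => h) redC noP.
  right; apply: (frame_cycle k2 F) => //.
  by have := cardsC V; rewrite card_ord cV mulnC; lia.
by right.
Qed.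

(** A red [P_n] is built around a blue [C_m] whose existence is granted by the
    previous formula. With [d] the difference of [n] and [m], induction on [n]
    provides a red [P_d] outside the cycle as soon as [m <= d]. *)
Lemma path_path_arrows k m n : 2 < k -> 2 < m -> m <= n ->
  (forall n, m <= n ->
    ramsey_arrows k ((k - 1) * n + (m + 1) %/ 2)
      (loose_path k n) (loose_cycle k m)) ->
  ramsey_arrows k ((k - 1) * n + (m + 1) %/ 2) (loose_path k n) (loose_path k m).
Proof.
move=> k2 m2 mn arr; elim/ltn_ind: n mn => n IH mn.
have k0 : 0 < k by lia.
apply: copy_in_arrows => [||c]; try exact: loose_path_uniform.
have [blueP|noP] := copy_in_dec (fun e => ~~ c e) setT (loose_path k m).
  by right.
left; have [|//|blueC] := @arrows_copy_in _ _ _ _ _ setT c (arr n mn).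
  by rewrite cardsT card_ord.
have m1 : 1 < m by lia.
have [V [x [B [F cV]]]] :=
  cycle_frame (Q := c) k2 m1 (fun e h => negbNE h) blueC noP.
have cV' : #|~: V| = (k - 1) * (n - m) + (m + 1) %/ 2.
  have := cardsC V; rewrite card_ord cV mulnC mulnBr.
  by have := leq_mul (leqnn (k - 1)) mn; lia.
suff [U [u [v P]]] : exists U u v, lpath k c U (n - m + m) u v.
  by have := lpath_copy k0 P; rewrite subnK //; apply/copy_in_sub/subsetT.
have m0 : 0 < m by lia.
have far U u v : lpath k c U (n - m) u v -> (forall z, z \in U -> z \notin V) ->
    exists U u v, lpath k c U (n - m + m) u v.
  move=> P UV; apply: (frame_attach k2 F m0 P UV).
  have UV0 : V :&: U = set0.
    by apply/setP=> z; rewrite !inE andbC; apply/negP=> /andP[/UV/negP].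
  have := cardsC (V :|: U); have := cardsC V.
  rewrite cardsU UV0 cards0 subn0 (card_lpath P) cV' [(n - m) * _]mulnC.
  by move: ((k - 1) * (n - m)) => q; lia.
have [d0|d0] := posnP (n - m).
  have [w wV] : exists w, w \in ~: V by apply/set0Pn; rewrite -card_gt0 cV'; lia.
  apply: (far [set w] w w); first by rewrite d0; apply: lpath_point.
  by move=> z /set1P->; rewrite inE in wV.
have [dm|md] := ltnP (n - m) m.
  by apply: (frame_long_path k2 F) => //; rewrite cV' mulnC.
have lt : n - m < n by lia.
have [|redP|blueP] := @arrows_copy_in _ _ _ _ _ (~: V) c (IH _ lt md).
- by rewrite cV'.
- have [U [u [v [P UV]]]] := copy_lpath (ltnW k2) redP.
  by apply: (far U u v P) => z /(subsetP UV); rewrite inE.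
- by case: noP; apply: (copy_in_sub (subsetT _) blueP).
Qed.

Theorem theorem2p2 (k : nat) (hk : 3 <= k) :
  (forall n m : nat, 3 <= m -> m <= n ->
     let N := (k - 1) * n + (m + 1) %/ 2 in
     is_ramsey k (loose_path k n) (loose_path k m) N /\
     is_ramsey k (loose_path k n) (loose_cycle k m) N /\
     exists r : nat,
       is_ramsey k (loose_cycle k n) (loose_cycle k m) r /\ r + 1 = N)
  <->
  (forall n m : nat, 3 <= m -> m <= n ->
     is_ramsey k (loose_cycle k n) (loose_cycle k m)
       ((k - 1) * n + (m - 1) %/ 2)).
Proof.
have half m : 3 <= m -> (m - 1) %/ 2 + 1 = (m + 1) %/ 2 by lia.
split=> [h n m m3 mn|h n m m3 mn N].
  have [_ [_ [r [rR rN]]]] := h n m m3 mn.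
  suff <- : r = (k - 1) * n + (m - 1) %/ 2 by [].
  by have := half m m3; lia.
have upC n' : m <= n' -> ramsey_arrows k ((k - 1) * n' + (m + 1) %/ 2)
    (loose_path k n') (loose_cycle k m).
  by move=> mn'; apply: path_cycle_arrows (h n' m m3 mn').1.
split; [|split].
- split; first exact: path_path_arrows.
  by move=> M; apply: path_path_lower_bound; lia.
- split; first exact: upC.
  by move=> M; apply: path_cycle_lower_bound; lia.
- exists ((k - 1) * n + (m - 1) %/ 2); split; first exact: h.
  by rewrite -addnA half.
Qed.
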